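(* Let $X$ be a complex normed space and let $\mathcal{C}=\{P_1,P_2\}$ be a family of generalized bi-circular idempotents on $X$. Then $P_1$ and $P_2$ are Lipschitz continuous.
   Context: Maps are not assumed to be linear. A map $P:X\to X$ is idempotent if $P\circ P=P$. A map $T:X\to X$ is an isometry if $\|Tx-Ty\|=\|x-y\|$ for all $x,y\in X$. A family of generalized bi-circular idempotents on $X$ is a collection $\{P_1,P_2\}$ of distinct nonzero idempotent maps on $X$ such that $P_1P_2=P_2P_1=0$, $P_1+P_2=I$ (the identity map), and $\lambda_1P_1+\lambda_2P_2$ is an isometry on $X$ for some distinct complex numbers $\lambda_1,\lambda_2$ of modulus one. *)

(* Defs.v *)
From HB Require Import structures.
From mathcomp Require Import all_boot all_order all_algebra.
From mathcomp Require Import complex.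
From mathcomp Require Import all_classical all_reals all_analysis.

Set Implicit Arguments.
Unset Strict Implicit.
Unset Printing Implicit Defensive.

Import Order.TTheory GRing.Theory Num.Theory.
Import numFieldNormedType.Exports.

Local Open Scope classical_set_scope.
Local Open Scope complex_scope.
Local Open Scope ring_scope.

(* A complex normed space is a [normedModType R[i]]; its norm takes values in
   R[i], and they are real and nonnegative for the order of R[i] (in which
   a <= b forces b - a to be real). Maps are arbitrary functions: no linearity
   is assumed anywhere. *)

Definition isometric (R : realType) (X : normedModType R[i]) (T : X -> X) :
    Prop :=
  forall x y : X, `|T x - T y| = `|x - y|.

Record generalized_bicircular (R : realType) (X : normedModType R[i])
    (P1 P2 : X -> X) : Prop := GeneralizedBicircular {
  gb_idem1 : idempotent_fun P1;
  gb_idem2 : idempotent_fun P2;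
  gb_nonzero1 : ~ (P1 =1 (fun=> 0));
  gb_nonzero2 : ~ (P2 =1 (fun=> 0));
  gb_distinct : ~ (P1 =1 P2);
  gb_comp12 : P1 \o P2 =1 (fun=> 0);
  gb_comp21 : P2 \o P1 =1 (fun=> 0);
  gb_sum : P1 \+ P2 =1 id;
  gb_isometry : exists l1 l2 : R[i],
    [/\ l1 != l2, `|l1| = 1, `|l2| = 1
      & isometric (fun x => l1 *: P1 x + l2 *: P2 x)]
}.

(* Main.v *)
Require Import Defs.
From HB Require Import structures.
From mathcomp Require Import all_boot all_order all_algebra.
From mathcomp Require Import complex.
From mathcomp Require Import all_classical all_reals all_analysis.
Import Order.TTheory GRing.Theory Num.Theory.
Import numFieldNormedType.Exports.
Local Open Scope classical_set_scope.
Local Open Scope complex_scope.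
Local Open Scope ring_scope.

(** The isometry [T = l1 P1 + l2 P2] and the identity [P1 + P2] are both
    Lipschitz, and since [l1 != l2] this pair of relations can be solved for the
    two components: [(l1 - l2) P1 = T - l2 I], and symmetrically
    [(l2 - l1) P2 = T - l1 I]. Each component is thus a linear combination of
    two Lipschitz maps; as [T] and [I] are 1-Lipschitz and the scalars have
    modulus one, the common constant is [2 / `|l1 - l2|]. *)

(** Eliminating [Q = id - P] from [T = a P + b Q] leaves [(a - b) P = T - b id],
    and the triangle inequality bounds the right-hand side. *)
Lemma klipschitz_component (K : numFieldType) (V : normedModType K)
    (a b k : K) (P Q : V -> V) :
    a != b -> P \+ Q =1 id -> k.-lipschitz (fun x => a *: P x + b *: Q x) ->
  ((k + `|b|) / `|a - b|).-lipschitz P.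
Proof.
move=> neq_ab PQ lipT [x y] _ /=.
have QE z : Q z = z - P z by rewrite (canRL (addKr (P z)) (PQ z)) addrC.
rewrite mulrAC ler_pdivlMr ?normr_gt0 ?subr_eq0// mulrC -normrZ.
have -> : (a - b) *: (P x - P y) =
    (a *: P x + b *: Q x) - (a *: P y + b *: Q y) - b *: (x - y).
  have TE z : a *: P z + b *: Q z = (a - b) *: P z + b *: z.
    by rewrite QE scalerBr scalerBl addrCA addrC.
  by rewrite !TE opprD addrACA -!scalerBr addrK.
rewrite mulrDl -normrZ (le_trans (ler_normB _ _))// lerD2r.
exact: (lipT (x, y)).
Qed.

Theorem proposition1p3 (R : realType) (X : normedModType R[i])
    (P1 P2 : X -> X) (hP : generalized_bicircular P1 P2) :
  lipschitz P1 /\ lipschitz P2.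
Proof.
have [l1 [l2 [neq_l _ _ isoT]]] := gb_isometry hP.
have lipT : 1.-lipschitz (fun x => l1 *: P1 x + l2 *: P2 x).
  by move=> [x y] _ /=; rewrite mul1r isoT.
have proper : ProperFilter (globally ([set: X] `*` [set: X])).
  by apply: (@globally_properfilter _ _ (0, 0)).
split.
  exact/klipschitzW/(klipschitz_component _ _ l1 l2 1 P1 P2 neq_l (gb_sum hP)).
apply/klipschitzW/(klipschitz_component _ _ l2 l1 1 P2 P1).
- by rewrite eq_sym.
- by move=> x; rewrite /= addrC; exact: gb_sum hP x.
- by move=> [x y] A; rewrite /= ![l2 *: _ + _]addrC; exact: (lipT (x, y)).
Qed.
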